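(* Let $2\leq g\leq n-1$ and let $D$ be a simple strongly connected digraph on $n$ vertices with girth $g$. Then $q(D)\geq q(C_{n,g})>2$, and $q(D)=q(C_{n,g})$ if and only if $D\cong C_{n,g}$.
   Context: Digraphs are finite and simple (no loops, no multiple arcs); pairs of opposite arcs are allowed and form a directed cycle of length 2. The girth is the length of a shortest directed cycle. $q(D)$ is the spectral radius of the signless Laplacian matrix $Q(D)=\mathrm{diag}(d_1^+,\ldots,d_n^+)+A(D)$, where $d_i^+$ is the outdegree of vertex $i$ and $A(D)$ is the adjacency matrix. For $2\leq g\leq n-1$, $C_{n,g}$ is the digraph with vertex set $\{u_1,\ldots,u_n\}$ and arc set $\{(u_i,u_{i+1}):1\leq i\leq n-1\}\cup\{(u_g,u_1),(u_n,u_1)\}$. *)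

(* Defs.v *)
From mathcomp Require Import all_boot all_order all_algebra complex.
From mathcomp Require Import classical_sets reals.

Set Implicit Arguments.
Unset Strict Implicit.
Unset Printing Implicit Defensive.
Import Order.TTheory GRing.Theory Num.Theory.
Local Open Scope ring_scope.
Local Open Scope classical_set_scope.

Section Digraph.
Variable n : nat.
Implicit Types (D E : rel 'I_n) (c : seq 'I_n).

(* Multiple arcs are excluded by representing the arc set as a relation. *)
Definition simple_digraph D := irreflexive D.

Definition strongly_connected D := forall i j, connect D i j.

Definition dicycle D c := (0 < size c)%N /\ ucycle D c.

Definition has_girth D (g : nat) :=
  (exists2 c, dicycle D c & size c = g) /\
  (forall c, dicycle D c -> (g <= size c)%N).

Definition isomorphic D E :=
  exists2 f : 'I_n -> 'I_n, bijective f & forall i j, E (f i) (f j) = D i j.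

Definition outdegree D (i : 'I_n) : nat := #|[pred j | D i j]|.

Definition adjacency_mx (R : pzRingType) D : 'M[R]_n :=
  \matrix_(i, j) (D i j)%:R.

Definition signless_laplacian (R : pzRingType) D : 'M[R]_n :=
  diag_mx (\row_i (outdegree D i)%:R) + adjacency_mx R D.

(* For n > 0 the set of eigenvalues is finite and nonempty, so that the
   supremum is a maximum. The norm of z : R[i] lives in R[i], hence Re. *)
Definition spectral_radius (R : realType) (A : 'M[R]_n) : R :=
  sup [set complex.Re `|z| | z in
        [set z : R[i] | eigenvalue (map_mx (real_complex R) A) z]].

Definition q (R : realType) D : R :=
  spectral_radius (signless_laplacian R D).

(* The vertex u_k is k - 1 : 'I_n. *)
Definition Cng (g : nat) : rel 'I_n := fun i j =>
  [|| j == i.+1 :> nat,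
      (i.+1 == g) && (j == 0 :> nat) |
      (i.+1 == n) && (j == 0 :> nat)].

End Digraph.

Arguments q {n} R D.
Arguments Cng : clear implicits.

(* Main.v *)
Require Import Defs.
From mathcomp Require Import all_boot all_order all_algebra complex.
From mathcomp Require Import classical_sets reals.
From mathcomp Require Import topology normedtype derive.
From mathcomp Require Import zify ring lra.
Import Order.TTheory GRing.Theory Num.Theory.
Local Open Scope ring_scope.

Set Implicit Arguments.
Unset Strict Implicit.
Unset Printing Implicit Defensive.

(* Let s in (0, 1) be the root of s + s^g + s^n = 1 and lambda = 1 + 1/s > 2.
   A g-cycle of D misses some vertex, so it has a vertex b with an arc leaving
   the cycle. Put y v = s^(d v), where d v is the distance from v to b. A vertex
   v <> b has an out-neighbour w with y w = y v / s, so (Q y) v >= lambda y v,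
   with equality iff w is the only out-neighbour. The out-neighbours of b
   include one at distance at most g - 1 (on the cycle) and another one at
   distance at most n - 1, whence (Q y) b >= 2 + s^(g-1) + s^(n-1) = lambda.
   By Perron-Frobenius q(D) >= lambda, with equality iff Q y = lambda y. In
   that case some vertex is at distance n - 1 from b, so that d is a bijection
   onto {0, ..., n - 1} and determines D as C_{n,g}. *)

(** * Perron-Frobenius theory by the Collatz-Wielandt method *)

Lemma eigenvalue_tr (F : fieldType) n (A : 'M[F]_n) (a : F) :
  eigenvalue A^T a = eigenvalue A a.
Proof.
rewrite !eigenvalue_root_char /char_poly -[\det (char_poly_mx A)]det_tr.
by rewrite /char_poly_mx raddfB /= tr_scalar_mx map_trmx.
Qed.

Section NonnegativeMatrix.
Import numFieldNormedType.Exports.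
Variables (R : realType) (n : nat).
Implicit Types (A P : 'M[R]_n) (x y : 'rV[R]_n) (a mu : R).

(** For a left eigenvector [v] with entrywise norm [w], the triangle inequality gives
    [|z| w <= w A]. Pairing with [y] yields [|z| (w . y) <= a (w . y)], and [w . y] is positive
    because [y] is positive and [v] nonzero. *)
Lemma norm_eigenvalue_le A y a (z : R[i]) :
    (forall i j, 0 <= A i j) -> (forall i, 0 < y 0 i) ->
    (forall i, (y *m A^T) 0 i <= a * y 0 i) ->
  eigenvalue (map_mx (real_complex R) A) z -> complex.Re `|z| <= a.
Proof.
move=> A0 y0 yA /eigenvalueP[v vA v_neq0].
have normRe (u : R[i]) : `|u| = (complex.Re `|u|)%:C%C by case: u.
pose w i := complex.Re `|v 0 i|.
have vw i : `|v 0 i| = (w i)%:C%C by exact: normRe.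
have w0 i : 0 <= w i by rewrite -ler0c -vw.
set r := complex.Re _.
have le_w j : r * w j <= \sum_i w i * A i j.
  rewrite -lecR rmorphM rmorph_sum /= -vw /r -normRe -normrM.
  move/rowP/(_ j): vA; rewrite !mxE => <-.
  apply: le_trans (ler_norm_sum _ _ _) _; apply: ler_sum => i _.
  rewrite mxE normrM rmorphM /= -vw ler_wpM2l //.
  by rewrite ger0_norm // ler0c.
have wy : 0 < \sum_j w j * y 0 j.
  rewrite lt_def sumr_ge0 ?andbT; last by move=> j _; rewrite mulr_ge0 // ltW.
  apply: contraNneq v_neq0 => /eqP; rewrite psumr_eq0 => [/allP w_eq0|j _];
    last by rewrite mulr_ge0 // ltW.
  apply/eqP/rowP => j; rewrite mxE; apply/eqP; rewrite -normr_eq0 vw.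
  have /= := w_eq0 j (mem_index_enum j).
  by rewrite mulf_eq0 (gt_eqF (y0 j)) orbF => /eqP ->.
rewrite -(ler_pM2r wy) !mulr_sumr.
apply: (@le_trans _ _ (\sum_j (\sum_i w i * A i j) * y 0 j)).
  by apply: ler_sum => j _; rewrite mulrA ler_wpM2r // ltW.
under eq_bigr do rewrite mulr_suml.
rewrite exchange_big /=; apply: ler_sum => i _.
rewrite mulrCA; under eq_bigr do rewrite -mulrA.
rewrite -mulr_sumr ler_wpM2l //; apply: le_trans (yA i).
by rewrite mxE; apply: ler_sum => j _; rewrite mxE mulrC.
Qed.

Lemma eigenvalue_le_spectral_radius A mu :
  (forall i j, 0 <= A i j) -> eigenvalue A mu -> mu <= spectral_radius A.
Proof.
move=> A0 Amu; apply: le_trans (ler_norm mu) _.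
have Amu' : eigenvalue (map_mx (real_complex R) A) mu%:C%C.
  by rewrite eigenvalue_map.
apply: sup_upper_bound; last first.
  by exists mu%:C%C => //; rewrite normc_def /= expr0n addr0 sqrtr_sqr.
split; first by exists (complex.Re `|mu%:C%C|), mu%:C%C.
(* The supremum needs an upper bound: the sum of all entries dominates every row sum, so the
   all-ones vector serves as [y]. *)
exists (\sum_i \sum_j A i j) => _ [z zA <-].
apply: (@norm_eigenvalue_le A (const_mx 1)) zA => // i; rewrite !mxE // mulr1.
under eq_bigr do rewrite !mxE mul1r.
by rewrite [leRHS](bigD1 i) //= lerDl sumr_ge0 // => k _; rewrite sumr_ge0.
Qed.

Lemma spectral_radius_eq A y a :
    (0 < n)%N -> (forall i j, 0 <= A i j) -> (forall i, 0 < y 0 i) ->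
    y *m A^T = a *: y ->
  spectral_radius A = a.
Proof.
move=> n_gt0 A0 y0 yA.
have Aa : eigenvalue A a.
  rewrite -eigenvalue_tr; apply/eigenvalueP; exists y => //.
  by apply/eqP => /rowP/(_ (Ordinal n_gt0))/eqP; rewrite mxE gt_eqF.
apply: le_anti; rewrite (eigenvalue_le_spectral_radius A0 Aa) andbT.
apply: ge_sup.
  by exists (complex.Re `|a%:C%C|), a%:C%C => //=; rewrite eigenvalue_map.
move=> _ [z zA <-]; apply: norm_eigenvalue_le zA => // i.
by rewrite yA mxE.
Qed.

(** Collatz-Wielandt condition: the largest [mu] that admits such an [x] will be shown to be an
    eigenvalue. *)
Definition subinvariant A mu x :=
  [/\ x != 0, forall i, 0 <= x 0 i & forall i, mu * x 0 i <= (x *m A) 0 i].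

Lemma subinvariant_normalize A mu x : subinvariant A mu x ->
  exists2 x', subinvariant A mu x' & \sum_i x' 0 i = 1.
Proof.
case=> x_neq0 x0 xA; set S := \sum_i x 0 i.
have S0 : 0 < S.
  rewrite lt_def sumr_ge0 // andbT; apply: contraNneq x_neq0 => /eqP.
  rewrite psumr_eq0 // => /allP x_eq0; apply/eqP/rowP => i; rewrite mxE.
  exact/eqP/x_eq0/mem_index_enum.
exists (S^-1 *: x); last first.
  by under eq_bigr do rewrite mxE; rewrite -mulr_sumr mulVf // gt_eqF.
split=> [|i|i]; rewrite ?scaler_eq0 ?invr_eq0 ?(gt_eqF S0) //.
  by rewrite mxE mulr_ge0 ?invr_ge0 // ltW.
by rewrite -scalemxAl !mxE mulrCA ler_wpM2l ?invr_ge0 ?(ltW S0) //;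
  have := xA i; rewrite mxE.
Qed.

(** Add up the inequalities over all coordinates; the entries of [x] are at most 1. This confines
    [mu] to a bounded interval. *)
Lemma subinvariant_le A mu x : (forall i j, 0 <= A i j) ->
  subinvariant A mu x -> \sum_i x 0 i = 1 -> mu <= \sum_i \sum_j A i j.
Proof.
move=> A0 [_ x0 xA] x1.
have x_le1 i : x 0 i <= 1.
  by rewrite -x1 (bigD1 i) //= lerDl sumr_ge0.
rewrite exchange_big /= -[mu]mulr1 -x1 mulr_sumr; apply: ler_sum => j _.
apply: le_trans (xA j) _; rewrite mxE; apply: ler_sum => i _.
by rewrite ler_piMl.
Qed.

(** The normalized subinvariant pairs with [mu >= a] form a compact set: [C1] is the normalization,
    [C2] the inequality, both closed in a box. The projection to [mu] attains its maximum there. *)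
Lemma subinvariant_max A a x : (forall i j, 0 <= A i j) ->
  subinvariant A a x ->
  exists mu y, subinvariant A mu y /\
    forall mu' y', subinvariant A mu' y' -> mu' <= mu.
Proof.
move=> A0 /subinvariant_normalize[x1 x1A x1_sum].
pose b := \sum_i \sum_j A i j.
pose box : set ('rV[R]_n * R) :=
  ([set y : 'rV[R]_n | forall i, `[0, 1]%classic (y 0 i)] `*` `[a, b])%classic.
pose C1 : set ('rV[R]_n * R) := [set p : 'rV[R]_n * R | \sum_i p.1 0 i = 1]%classic.
pose C2 : set ('rV[R]_n * R) :=
  (\bigcap_i [set p : 'rV[R]_n * R | 0 <= \sum_j p.1 0 j * A j i - p.2 * p.1 0 i])%classic.
have box_compact : compact box.
  apply: compact_setX; last exact: segment_compact.
  apply: (@rV_compact R n (fun=> `[0, 1]%classic)) => i.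
  exact: segment_compact.
have coordC i : continuous (fun p : 'rV[R]_n * R => p.1 0 i).
  move=> p; apply: (@continuous_comp _ _ _ fst (fun y : 'rV[R]_n => y 0 i)).
    exact: cvg_fst.
  exact: coord_continuous.
have C1_closed : closed C1.
  apply: (@preimage_closed _ _ (fun p : 'rV[R]_n * R => \sum_i p.1 0 i)
    [set r | r = 1]%classic) => // p _.
  by apply: cvg_big => [|i _]; [exact: add_continuous | exact: coordC].
have C2_closed : closed C2.
  apply: closed_bigI => i _.
  apply: (@preimage_closed _ _
    (fun p : 'rV[R]_n * R => \sum_j p.1 0 j * A j i - p.2 * p.1 0 i)
    [set r | 0 <= r]%classic) => // p _.
  apply: cvgB; last by apply: cvgM; [exact: cvg_snd | exact: coordC].
  apply: cvg_big => [|j _]; first exact: add_continuous.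
  by apply: cvgM; [exact: coordC | exact: cvg_cst].
have feasible mu y : subinvariant A mu y -> \sum_i y 0 i = 1 -> a <= mu ->
    (box `&` C1 `&` C2)%classic (y, mu).
  move=> yA y1 amu; have mub := subinvariant_le A0 yA y1.
  case: yA => _ y0 yA; split; last first.
    by move=> i _; rewrite /= subr_ge0; have := yA i; rewrite mxE.
  split=> //; split=> [i|] /=; rewrite in_itv /= ?amu //.
  by rewrite y0 -y1 (bigD1 i) //= lerDl sumr_ge0.
have K_compact : compact (box `&` C1 `&` C2)%classic.
  by apply: compact_closedI => //; exact: compact_closedI.
have [||[y mu] /set_mem[[[/= y01 amub] y1] yA] y_max] :=
  @compact_EVT_max _ _ (fun p : 'rV[R]_n * R => p.2) _ _ K_compact.
- by exists (x1, a); exact: feasible.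
- by apply: continuous_subspaceT => p; exact: cvg_snd.
exists mu, y; split.
  split=> [|i|i].
  - apply: contra_eq_neq y1 => ->; rewrite /C1 /=.
    by under eq_bigr do rewrite mxE; rewrite big1 // eq_sym oner_eq0.
  - by have := y01 i; rewrite /= in_itv /= => /andP[].
  - by have := yA i I; rewrite /= subr_ge0 mxE.
move=> mu' y' /subinvariant_normalize[z zA z1].
(* Pairs with [mu' < a] lie outside the box, but the maximum is at least [a]. *)
have [amu'|/ltW mu'a] := leP a mu'.
  by apply: (y_max (z, mu')); apply/mem_set/feasible.
by apply: le_trans mu'a _; move: amub; rewrite in_itv /= => /andP[].
Qed.

(* If P > 0 commutes with A, then x |-> x P turns a nonzero defect x A - mu x
   into a positive one, which leaves room for a larger mu. *)
Lemma subinvariant_improve A P mu x :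
    (forall i j, 0 < P i j) -> P *m A = A *m P ->
    subinvariant A mu x -> x *m A != mu *: x ->
  exists mu' y, subinvariant A mu' y /\ mu < mu'.
Proof.
move=> P0 PA [x_neq0 x0 xA] neq_xA.
have pos (z : 'rV[R]_n) : z != 0 -> (forall i, 0 <= z 0 i) -> forall j, 0 < (z *m P) 0 j.
  move=> z_neq0 z0 j; rewrite mxE.
  have [i zi] : exists i, z 0 i != 0.
    apply/existsP; apply: contraNT z_neq0; rewrite negb_exists => /forallP z_eq0.
    by apply/eqP/rowP => i; rewrite mxE; apply/eqP/negPn.
  rewrite (bigD1 i) //= ltr_pwDl ?sumr_ge0 // => [|k _].
    by rewrite mulr_gt0 // lt_def zi z0.
  by rewrite mulr_ge0 // ltW.
pose w := x *m A - mu *: x.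
have w_pos := pos w; have y_pos := pos x x_neq0 x0.
have {}w_pos : forall j, 0 < (w *m P) 0 j.
  apply: w_pos => [|i]; rewrite ?subr_eq0 // /w !mxE subr_ge0.
  by have := xA i; rewrite mxE.
set y := x *m P in y_pos.
have wP : w *m P = y *m A - mu *: y.
  by rewrite mulmxBl -scalemxAl -!mulmxA PA.
(* The largest gain that every coordinate allows; the default 1 merely caps it. *)
pose e := \big[Num.min/1]_j ((w *m P) 0 j / y 0 j).
have e0 : 0 < e.
  by apply: lt_bigmin => // j _; rewrite divr_gt0.
exists (mu + e), y; split; last by rewrite ltrDl.
split=> [|i|i].
- have [i _|n0] := pickP (@predT 'I_n).
    by apply/eqP => /rowP/(_ i)/eqP; rewrite [X in _ == X]mxE gt_eqF.
  by case/eqP: x_neq0; apply/rowP => i; have := n0 i.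
- exact: ltW.
- rewrite mulrDl -lerBrDl.
  have -> : (y *m A) 0 i - mu * y 0 i = (w *m P) 0 i by rewrite wP !mxE.
  by rewrite -ler_pdivlMr // /e; exact: bigmin_le.
Qed.

(** At the maximal [mu] no improvement is possible, so its vector has no defect and is an
    eigenvector. A defect of [x] at [a] can be improved, which puts [a] strictly below the
    maximum. *)
Lemma perron_root A P a x :
    (forall i j, 0 <= A i j) -> (forall i j, 0 < P i j) -> P *m A = A *m P ->
    subinvariant A a x ->
  exists mu, [/\ eigenvalue A mu, a <= mu & x *m A != a *: x -> a < mu].
Proof.
move=> A0 P0 PA xA.
have [mu [y [yA mu_max]]] := subinvariant_max A0 xA.
exists mu; split; last 2 first.
- exact: mu_max xA.
- move=> /(subinvariant_improve P0 PA xA)[mu' [y' [y'A lt_a]]].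
  exact: lt_le_trans lt_a (mu_max _ _ y'A).
apply/eigenvalueP; exists y; last by case: yA.
apply/eqP; apply: contraT => /(subinvariant_improve P0 PA yA)[mu' [y' [y'A]]].
by rewrite ltNge (mu_max _ _ y'A).
Qed.

End NonnegativeMatrix.

(** * Bounds on [q] from positive test vectors *)

Section SignlessLaplacian.
Variables (R : realType) (n : nat).
Implicit Types (D : rel 'I_n) (y : 'rV[R]_n) (a : R).

Lemma mul_signless_laplacian D y i :
  (y *m (signless_laplacian R D)^T) 0 i = \sum_(j | D i j) (y 0 i + y 0 j).
Proof.
rewrite mxE; under eq_bigr do rewrite !mxE mulrDr.
rewrite !big_split /= (bigD1 i) //= eqxx mulr1n [X in _ * _ + X]big1 => [|j ji].
  rewrite addr0 sumr_const mulr_natr; congr (_ + _).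
  by rewrite [RHS]big_mkcond; apply: eq_bigr => j _; rewrite mulr_natr mulrb.
by rewrite eq_sym (negPf ji) mulr0.
Qed.

Lemma signless_laplacian_ge0 D i j : 0 <= signless_laplacian R D i j.
Proof. by rewrite !mxE addr_ge0 ?mulrn_wge0. Qed.

(** For each pair some power of [A] is positive at that entry, by strong connectivity. The sum of
    these powers is positive everywhere and commutes with [A]. *)
Lemma strongly_connected_pos_commuting D : strongly_connected D ->
  let A := (signless_laplacian R D)^T in
  exists2 P : 'M_n, forall i j, 0 < P i j & P *m A = A *m P.
Proof.
move=> Dconn A.
have A0 i j : 0 <= A i j by rewrite mxE signless_laplacian_ge0.
have Ak0 k i j : 0 <= (A ^+ k) i j.
  elim: k i j => [|k IHk] i j; first by rewrite expr0 mxE ler0n.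
  by rewrite exprS mxE sumr_ge0 // => l _; rewrite mulr_ge0.
have /fin_all_exists[k kP] (ij : 'I_n * 'I_n) : exists k, 0 < (A ^+ k) ij.1 ij.2.
  (* [A] is a transpose, so entry [(i, j)] calls for a path from [j] to [i]. *)
  case: ij => i j /=; have /connectP[p Dp ->] := Dconn j i.
  elim: p j Dp => [|l p IHp] j /=; first by exists 0; rewrite expr0 mxE eqxx.
  case/andP=> Djl /IHp[k kp]; exists k.+1.
  rewrite exprSr mxE (bigD1 l) //= ltr_pwDl ?sumr_ge0 // => [|m _].
    rewrite mulr_gt0 // !mxE Djl ltr_wpDl // mulrn_wge0 //.
  by rewrite mulr_ge0.
exists (\sum_ij A ^+ k ij) => [i j|].
  rewrite summxE (bigD1 (i, j)) //= ltr_pwDl ?sumr_ge0 //; exact: (kP (i, j)).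
rewrite mulmx_suml mulmx_sumr; apply: eq_bigr => ij _.
by rewrite !mulmxE -exprSr exprS.
Qed.

Lemma q_eq D y a : (0 < n)%N -> (forall i, 0 < y 0 i) ->
    (forall i, \sum_(j | D i j) (y 0 i + y 0 j) = a * y 0 i) ->
  q R D = a.
Proof.
move=> n_gt0 y0 yD; apply: (spectral_radius_eq n_gt0 _ y0) => [i j|].
  exact: signless_laplacian_ge0.
by apply/rowP => i; rewrite mul_signless_laplacian yD mxE.
Qed.

Lemma q_ge D y a : (0 < n)%N -> strongly_connected D ->
    (forall i, 0 < y 0 i) ->
    (forall i, a * y 0 i <= \sum_(j | D i j) (y 0 i + y 0 j)) ->
  a <= q R D /\
  (q R D <= a -> forall i, \sum_(j | D i j) (y 0 i + y 0 j) = a * y 0 i).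
Proof.
move=> n_gt0 Dconn y0 yD.
have [P P0 PA] := strongly_connected_pos_commuting Dconn.
set A := (signless_laplacian R D)^T in PA.
have A0 i j : 0 <= A i j by rewrite mxE signless_laplacian_ge0.
have yA : subinvariant A a y.
  split=> [|i|i]; last by rewrite mul_signless_laplacian.
    by apply/eqP => /rowP/(_ (Ordinal n_gt0))/eqP; rewrite mxE gt_eqF.
  exact: ltW.
have [mu [Amu amu lt_amu]] := perron_root A0 P0 PA yA.
have muq : mu <= q R D.
  rewrite eigenvalue_tr in Amu; apply: eigenvalue_le_spectral_radius Amu => i j.
  exact: signless_laplacian_ge0.
split=> [|qa i]; first exact: le_trans muq.
rewrite -mul_signless_laplacian -/A.
have [->|/lt_amu] := eqVneq (y *m A) (a *: y); first by rewrite mxE.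
by rewrite ltNge (le_trans muq).
Qed.

End SignlessLaplacian.

(** * The extremal digraph and its spectral radius *)

Lemma isomorphic_sym n (D E : rel 'I_n) : isomorphic D E -> isomorphic E D.
Proof.
case=> f [h fK hK] fP; exists h; first by exists f.
by move=> i j; rewrite -fP !hK.
Qed.

Lemma isomorphic_trans n (D E F : rel 'I_n) :
  isomorphic D E -> isomorphic E F -> isomorphic D F.
Proof.
case=> f f_bij fP [h h_bij hP]; exists (h \o f); first exact: bij_comp.
by move=> i j /=; rewrite hP fP.
Qed.

(* C_{n,g} with every vertex renamed to its distance to the vertex u_g. *)
Definition layered n g : rel 'I_n := fun i j =>
  if i == 0 :> nat then (j.+1 == g) || (j.+1 == n) else i == j.+1 :> nat.
Arguments layered : clear implicits.

Lemma Cng_isomorphic_layered n g : (0 < g)%N -> (g < n)%N ->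
  isomorphic (Cng n g) (layered n g).
Proof.
move=> g0 gn.
(* Index [i] stands for [u_(i+1)]. Up to [u_g] the path runs straight to [u_g]; beyond, it takes
   [n - i] arcs through [u_n] to [u_1] and [g - 1] more. *)
have f_lt (i : 'I_n) : ((if i < g then g.-1 - i else n + g.-1 - i) < n)%N.
  by have := ltn_ord i; case: ifP; lia.
have f_inj : injective (fun i => Ordinal (f_lt i)).
  move=> i j [] eq_ij; apply: val_inj => /=.
  have := ltn_ord i; have := ltn_ord j; move: eq_ij.
  by case: ifP; case: ifP; lia.
exists (fun i => Ordinal (f_lt i)); first exact: injF_bij.
move=> i j; rewrite /layered /Cng /=.
have := ltn_ord i; have := ltn_ord j.
by case: ifP; case: ifP; case: ifP; lia.
Qed.

(** The vector [s ^ k] on layer [k] is a positive eigenvector: layer [k > 0] gives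
    [s ^ k + s ^ (k - 1)], and layer 0 gives [2 + s ^ (g - 1) + s ^ (n - 1)], which is [1 + 1/s] by
    the equation for [s] divided by [s]. *)
Lemma q_layered (R : realType) n g (D : rel 'I_n) (s : R) :
    (0 < g)%N -> (g < n)%N -> 0 < s -> s + s ^+ g + s ^+ n = 1 ->
  isomorphic D (layered n g) -> q R D = 1 + s^-1.
Proof.
move=> g0 gn s0 s_eq [f f_bij fP].
have sV k : (0 < k)%N -> s ^+ k.-1 = s^-1 * s ^+ k.
  by move=> k0; rewrite -[in RHS](prednK k0) exprS mulKf // gt_eqF.
apply: (q_eq (y := \row_i s ^+ f i)) => [|i|i]; first exact: leq_trans gn.
  by rewrite mxE exprn_gt0.
under eq_bigr do rewrite !mxE.
under eq_bigl do rewrite -fP.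
rewrite -(reindex f (P := layered n g (f i)) (F := fun k => s ^+ f i + s ^+ k));
  last exact: onW_bij.
rewrite !mxE /layered; move: (f i) => k; case: eqP => [->|/eqP k0].
  have n0 : (n.-1 < n)%N by lia.
  have g1 : (g.-1 < n)%N by lia.
  rewrite (bigD1 (Ordinal g1)) ?prednK ?eqxx //=.
  rewrite (big_pred1 (Ordinal n0)) /= => [|j]; last first.
    by rewrite /= -!val_eqE /=; have := ltn_ord j; lia.
  rewrite !sV //; last lia.
  have sVE : s^-1 = 1 + s^-1 * s ^+ g + s^-1 * s ^+ n.
    by rewrite -(mulVf (lt0r_neq0 s0)) -!mulrDr s_eq mulr1.
  by rewrite expr0 mulr1 [in RHS]sVE; ring.
have k1 : (k.-1 < n)%N by have := ltn_ord k; lia.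
rewrite (big_pred1 (Ordinal k1)) /= => [|j]; last first.
  by rewrite /= -val_eqE /=; have := ltn_ord j; lia.
by rewrite sV ?lt0n // mulrDl mul1r.
Qed.

(** * Distances to a fixed vertex *)

Lemma distance_exists n (D : rel 'I_n) b : strongly_connected D ->
  exists d : 'I_n -> nat,
    [/\ d b = 0%N,
        forall v p, path D v p -> last v p = b -> (d v <= size p)%N &
        forall v, v != b -> exists2 w, D v w & d v = (d w).+1].
Proof.
move=> Dconn.
pose reach v k := [exists p : k.-tuple 'I_n, path D v p && (last v p == b)].
have reachP v p : path D v p -> last v p = b -> reach v (size p).
  by move=> Dp pb; apply/existsP; exists (in_tuple p); rewrite Dp pb /=.
have reach_ex v : exists k, reach v k.
  by have /connectP[p Dp bp] := Dconn v b; exists (size p); exact: reachP.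
pose d v := ex_minn (reach_ex v).
have d_le v p : path D v p -> last v p = b -> (d v <= size p)%N.
  by move=> Dp pb; rewrite /d; case: ex_minnP => k _; apply; exact: reachP.
exists d; split=> // [|v vb].
  by apply/eqP; rewrite -leqn0; exact: (d_le b [::]).
have [p dp /andP[Dp pb]] : exists2 p, size p = d v & path D v p && (last v p == b).
  rewrite {1}/d; case: ex_minnP => k /existsP[p Dp] _.
  by exists p; rewrite ?size_tuple.
case: p dp Dp pb => [|w p] /= dp; first by move=> _ /eqP vb'; rewrite vb' eqxx in vb.
case/andP=> Dvw Dp /eqP pb; exists w => //; rewrite -dp; congr _.+1.
(* The tail of a shortest path is shortest: a shorter path from [w] would extend to a shorter one
   from [v]. *)
apply/eqP; rewrite eqn_leq d_le // andbT.
have [r dr /andP[Dr rb]] : exists2 r, size r = d w & path D w r && (last w r == b).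
  rewrite {1}/d; case: ex_minnP => k /existsP[r Dr] _.
  by exists r; rewrite ?size_tuple.
rewrite -ltnS dp -dr; apply: (d_le v (w :: r)); first by rewrite /= Dvw.
exact/eqP.
Qed.

Section Descent.
Variables (n : nat) (b : 'I_n) (d : 'I_n -> nat).
Hypothesis d_pred : forall v, v != b -> exists w, d v = (d w).+1.
Hypothesis d_b : d b = 0%N.

(* Descending from v along arcs visits every level below d v. *)
Lemma descent_iota v : {subset iota 0 (d v).+1 <= codom d}.
Proof.
move=> m; rewrite mem_iota /= add0n ltnS.
move dv: (d v) => k; elim: k v dv => [|k IHk] v dv.
  by rewrite leqn0 => /eqP ->; rewrite -dv codom_f.
rewrite leq_eqVlt => /predU1P[->|]; first by rewrite -dv codom_f.
have vb : v != b by apply: contra_eq_neq dv => ->; rewrite d_b.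
have [w dw] := d_pred vb; rewrite ltnS; apply: (IHk w).
by apply: succn_inj; rewrite -dw.
Qed.

Lemma descent_lt v : (d v < n)%N.
Proof.
have := uniq_leq_size (iota_uniq 0 (d v).+1) (@descent_iota v).
by rewrite size_iota size_codom card_ord.
Qed.

(** The [n] values of [d] then cover [n] distinct levels, so none repeats. *)
Lemma descent_inj v : d v = n.-1 -> injective d.
Proof.
move=> dv; apply/injectiveP.
apply: (leq_size_uniq (iota_uniq 0 (d v).+1) (@descent_iota v)).
by rewrite size_iota size_codom card_ord dv leqSpred.
Qed.

End Descent.

(** * The lower bound and its equality case *)

(* The test vector is y v = s ^ d v, with d v the distance from v to b. *)
Lemma layered_extremal (R : realType) n g (D : rel 'I_n) (s : R) b j k :
    strongly_connected D -> (g < n)%N -> 0 < s < 1 ->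
    s + s ^+ g + s ^+ n = 1 ->
    D b j -> (exists p, [/\ path D j p, last j p = b & size p = g.-1]) ->
    D b k -> j != k -> (0 < g)%N ->
  1 + s^-1 <= q R D /\ (q R D <= 1 + s^-1 -> isomorphic D (layered n g)).
Proof.
move=> Dconn gn /andP[s0 s1] s_eq Dbj [p [Dp pb pg]] Dbk jk g0.
have [d [db d_le d_pred]] := distance_exists b Dconn.
have d_pred' v : v != b -> exists w, d v = (d w).+1.
  by move=> /d_pred[w _]; exists w.
have d_lt := descent_lt d_pred' db.
have dj : (d j <= g.-1)%N by rewrite -pg d_le.
have dk : (d k <= n.-1)%N by have := d_lt k; lia.
pose y : 'rV[R]_n := \row_i s ^+ d i.
have y0 i : 0 < y 0 i by rewrite mxE exprn_gt0.
have sumE i : \sum_(l | D i l) (y 0 i + y 0 l) =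
    \sum_(l | D i l) (s ^+ d i + s ^+ d l).
  by apply: eq_bigr => l _; rewrite !mxE.
have pos (Q : pred 'I_n) i : 0 <= \sum_(l | Q l) (s ^+ d i + s ^+ d l).
  by rewrite sumr_ge0 // => l _; rewrite addr_ge0 // exprn_ge0 // ltW.
have pos_eq0 (Q : pred 'I_n) i :
    \sum_(l | Q l) (s ^+ d i + s ^+ d l) <= 0 -> Q =1 pred0.
  move=> sum_le0 l; apply: contraTF sum_le0 => Ql; rewrite -ltNge.
  by rewrite (bigD1 l) //= ltr_pwDl // ?addr_gt0 ?exprn_gt0.
(* The arc to [w] alone contributes [(1 + 1/s) y v]; the other arcs are the excess. *)
have sumV v w : D v w -> d v = (d w).+1 ->
    \sum_(l | D v l) (y 0 v + y 0 l) = (1 + s^-1) * y 0 v +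
    \sum_(l | D v l && (l != w)) (s ^+ d v + s ^+ d l).
  move=> Dvw dv; rewrite sumE (bigD1 w) //= mxE; congr (_ + _).
  by rewrite dv exprS mulrDl mul1r mulKf ?gt_eqF.
(* With [1 + 1/s = 2 + s ^ (g - 1) + s ^ (n - 1)], the excess at [b] splits into three nonnegative
   terms. *)
have sumB : \sum_(l | D b l) (y 0 b + y 0 l) = (1 + s^-1) * y 0 b +
    ((s ^+ d j - s ^+ g.-1) + (s ^+ d k - s ^+ n.-1) +
    \sum_(l | [&& D b l, l != j & l != k]) (s ^+ d b + s ^+ d l)).
  rewrite sumE (bigD1 j) //= (bigD1 k) /=; last by rewrite Dbk eq_sym.
  have sVE : s^-1 = 1 + s ^+ g.-1 + s ^+ n.-1.
    apply: (mulfI (lt0r_neq0 s0)); rewrite mulfV ?gt_eqF //.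
    by rewrite !mulrDr mulr1 -!exprS !prednK ?s_eq //; lia.
  under [in RHS]eq_bigl do rewrite andbA.
  rewrite sVE [y 0 b]mxE db expr0; ring.
have le_j : s ^+ g.-1 <= s ^+ d j by rewrite ler_wiXn2l ?ltW.
have le_k : s ^+ n.-1 <= s ^+ d k by rewrite ler_wiXn2l ?ltW.
have n0 : (0 < n)%N by exact: leq_trans gn.
have [|le_q eq_q] := q_ge n0 Dconn y0 (a := 1 + s^-1).
  move=> i; have [->|/d_pred[w Diw di]] := eqVneq i b.
    by rewrite sumB lerDl addr_ge0 ?pos // addr_ge0 ?subr_ge0.
  by rewrite (sumV _ _ Diw di) lerDl pos.
split=> // /eq_q {}eq_q.
(* Equality makes all three terms vanish; powers of [s] determine their exponents since
   [0 < s < 1]. *)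
have : [/\ d j = g.-1, d k = n.-1 & forall l, D b l -> (l == j) || (l == k)].
  have := eq_q b; rewrite sumB -[RHS]addr0 => /addrI.
  set S := \sum_(l | _) _ => sum_eq0; have S0 : 0 <= S by exact: pos.
  have s_inj : injective (GRing.exp s) by apply: ieexprIn; rewrite ?lt_eqF.
  split; [apply: s_inj; lra | apply: s_inj; lra |].
  have /pos_eq0 S_eq0 : S <= 0 by lra.
  move=> l Dbl; have := S_eq0 l.
  by rewrite /= Dbl /=; case: (l == j); case: (l == k).
case=> {}dj {}dk Db.
have d_inj := descent_inj d_pred' db dk.
exists (fun v => Ordinal (d_lt v)); first by apply: injF_bij => v w [/d_inj].
move=> v w; rewrite /layered /=.
have [->|/[dup] vb /d_pred[u Dvu dv]] := eqVneq v b.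
  rewrite db eqxx; apply/idP/idP => [|/Db/orP[]/eqP ->]; last 2 first.
  - by rewrite dj prednK ?eqxx.
  - by rewrite dk prednK ?eqxx ?orbT.
  case/orP=> /eqP dw; [have -> : w = j | have -> : w = k] => //; apply: d_inj.
    by rewrite dj -dw.
  by rewrite dk -[in RHS]dw.
rewrite dv /= eqSS (inj_eq d_inj); apply/eqP/idP => [<- //|Dvw].
(* No excess at [v] means that [u] is its only out-neighbour. *)
have /pos_eq0/(_ w) : \sum_(l | D v l && (l != u)) (s ^+ d v + s ^+ d l) <= 0.
  by rewrite -(lerD2l ((1 + s^-1) * y 0 v)) -(sumV _ _ Dvu dv) eq_q addr0.
by rewrite /= Dvw; case: eqP.
Qed.

(** * The branching vertex, the root [s] and the theorem *)

Lemma dicycle_exit n (D : rel 'I_n) c :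
    strongly_connected D -> dicycle D c -> (size c < n)%N ->
  exists b j k, [/\ D b j, D b k, j != k &
    exists p, [/\ path D j p, last j p = b & size p = (size c).-1]].
Proof.
move=> Dconn [c_gt0 /andP[Dc c_uniq]] cn.
have [b [k [bc Dbk kc]]] : exists b k, [/\ b \in c, D b k & k \notin c].
  have [/existsP[b /existsP[k /and3P[]]]|] :=
    boolP [exists b, exists k, [&& b \in c, D b k & k \notin c]].
    by exists b, k.
  (* If no arc left [c], every path from [c] would stay in it, so [c] would contain all [n]
     vertices. *)
  move=> /existsPn c_closed; move: cn; rewrite ltnNge => /negP[].
  rewrite -[X in (X <= _)%N]size_enum_ord.
  apply: uniq_leq_size (enum_uniq _) _ => v _.
  have stay u p : u \in c -> path D u p -> last u p \in c.
    elim: p u => //= w p IHp u uc /andP[Duw]; apply: IHp.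
    by have /existsPn/(_ w) := c_closed u; rewrite uc Duw negbK.
  have x_c : nth v c 0 \in c by exact: mem_nth.
  by have /connectP[p Dp ->] := Dconn (nth v c 0) v; exact: stay.
have [i s rot_c] := rot_to bc.
have s_size : size s = (size c).-1 by rewrite -(size_rot i c) rot_c.
have sub_s v : v \in rcons s b -> v \in c.
  by rewrite mem_rcons -rot_c mem_rot.
have : path D b (rcons s b) by rewrite -[path _ _ _]/(cycle D (b :: s)) -rot_c rot_cycle.
case: s s_size sub_s {rot_c} => [|j s] s_size sub_s /= /andP[Dbj Dj].
  (* A cycle of length 1 is a loop at [b], closed by the empty path. *)
  exists b, b, k; split=> //; first by apply: contraNneq kc => <-.
  by exists [::].
exists b, j, k; split=> //.
  by apply: contraNneq kc => <-; rewrite sub_s ?mem_head.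
by exists (rcons s b); rewrite last_rcons size_rcons.
Qed.

Lemma layered_root (R : rcfType) g n : (0 < g)%N -> (0 < n)%N ->
  exists2 s : R, 0 < s < 1 & s + s ^+ g + s ^+ n = 1.
Proof.
move=> g0 n0.
pose p : {poly R} := 'X + 'X^g + 'X^n - 1.
have pE x : p.[x] = x + x ^+ g + x ^+ n - 1 by rewrite !hornerE.
have p0 : p.[0] = -1 by rewrite pE !expr0n !gtn_eqF // !add0r.
have p1 : p.[1] = 2 by rewrite pE !expr1n; ring.
have [||s /andP[s0 s1] /eqP ps] := @poly_ivt _ p 0 1; rewrite ?p0 ?p1 //.
  by rewrite ler0n oppr_le0 ler01.
(* The intermediate value theorem gives a root in the closed interval; the values -1 and 2 exclude
   its ends. *)
have neq (x : R) : p.[x] != 0 -> s != x by apply: contraNneq => <-; rewrite ps.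
exists s; last by apply/eqP; rewrite -subr_eq0 -pE ps.
by rewrite !lt_neqAle s0 s1 eq_sym !neq // ?p0 ?p1 ?pnatr_eq0 // oppr_eq0 oner_eq0.
Qed.

Theorem theorem5p2 (R : realType) (n g : nat) (hg2 : (2 <= g)%N)
    (hgn : (g <= n - 1)%N) (D : rel 'I_n) (hsimple : simple_digraph D)
    (hconn : strongly_connected D) (hgirth : has_girth D g) :
  [/\ q R (Cng n g) <= q R D,
      2 < q R (Cng n g) &
      q R D = q R (Cng n g) <-> isomorphic D (Cng n g)].
Proof.
have g0 : (0 < g)%N by lia.
have gn : (g < n)%N by lia.
have [s s01 s_eq] := layered_root R g0 (leq_trans g0 (ltnW gn)).
have /andP[s0 s1] := s01.
have C_iso := Cng_isomorphic_layered g0 gn.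
have [[c c_cycle cg] _] := hgirth.
have cn : (size c < n)%N by rewrite cg.
have [b [j [k [Dbj Dbk jk]]]] := dicycle_exit hconn c_cycle cn.
rewrite cg => p_ex.
have [le_q eq_q] := layered_extremal hconn gn s01 s_eq Dbj p_ex Dbk jk g0.
have qC : q R (Cng n g) = 1 + s^-1 := q_layered g0 gn s0 s_eq C_iso.
rewrite qC; split; first exact: le_q.
  (* Here [1 + 1/s > 1 + 1] amounts to [s < 1]. *)
  by rewrite [ltLHS]mulr2n ltrD2l invf_gt1.
split=> [qD|D_iso].
  apply: isomorphic_trans (isomorphic_sym C_iso).
  by apply: eq_q; rewrite qD.
by apply: (q_layered g0 gn s0 s_eq); exact: isomorphic_trans C_iso.
Qed.
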